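(* Let $n\ge 2$ be an integer and let $D_{2n}$ be the dihedral group of order $2n$. Then: (a) $D_{2n}$ is quasi-Leinster if and only if $n$ is odd and quasi-perfect; (b) $D_{2n}$ is almost Leinster if and only if $n$ is odd and almost perfect; (c) $D_{2n}$ is Leinster if and only if $n$ is odd and perfect.
   Context: $D_{2n}=\langle r,s\mid r^n=s^2=e,\ srs^{-1}=r^{-1}\rangle$ for $n\ge 2$ (so $D_4$ is the Klein four-group). For a positive integer $n$ let $D(n)=\sum_{d\mid n} d$ be the sum of all positive divisors of $n$; $n$ is perfect if $D(n)=2n$, quasi-perfect if $D(n)=2n+1$, and almost perfect if $D(n)=2n-1$. For a finite group $G$ let $D(G)=\sum_{N\trianglelefteq G}|N|$, the sum of the orders of all normal subgroups of $G$ (including the trivial subgroup and $G$ itself). The group $G$ is Leinster if $D(G)=2|G|$, quasi-Leinster if $D(G)=2|G|+1$, and almost Leinster if $D(G)=2|G|-1$. *)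

(* Defs.v *)
From mathcomp Require Import all_boot all_fingroup all_solvable.

Set Implicit Arguments.
Unset Strict Implicit.
Unset Printing Implicit Defensive.

Import GroupScope.
Local Open Scope nat_scope.

Definition sum_divisors (n : nat) : nat := \sum_(d <- divisors n) d.

(* The conjunct 0 < n is needed because divisors 0 = [::]. *)
Definition perfect (n : nat) : Prop :=
  0 < n /\ sum_divisors n = 2 * n.
Definition quasi_perfect (n : nat) : Prop :=
  0 < n /\ sum_divisors n = 2 * n + 1.
Definition almost_perfect (n : nat) : Prop :=
  0 < n /\ sum_divisors n = 2 * n - 1.

Definition sum_normal_orders (gT : finGroupType) (G : {group gT}) : nat :=
  \sum_(N : {group gT} | N <| G) #|N|.

Definition Leinster (gT : finGroupType) (G : {group gT}) : Prop :=
  sum_normal_orders G = 2 * #|G|.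
Definition quasi_Leinster (gT : finGroupType) (G : {group gT}) : Prop :=
  sum_normal_orders G = 2 * #|G| + 1.
Definition almost_Leinster (gT : finGroupType) (G : {group gT}) : Prop :=
  sum_normal_orders G = 2 * #|G| - 1.

(* The library proves Grp_dihedral with the relator r ^ s = s^-1 * r * s; this
   is the presentation with s * r * s^-1. *)
Lemma dihedral_presentation (n : nat) : 1 < n ->
  'D_(2 * n) \isog Grp (r : s : r ^+ n, s ^+ 2, s * r * s^-1 = r^-1)%g.
Proof.
move=> n_gt1; rewrite mul2n => gT G; rewrite Grp_dihedral //.
apply: eq_existsb => -[r s] /=; rewrite !xpair_eqE.
congr (_ && (_ && _)); apply: andb_id2l => /eqP s2.
have sV : s^-1%g = s by apply/eqP; rewrite eq_invg_mul -(expgS s 1) s2.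
by rewrite /conjg sV mulgA.
Qed.

(* Main.v *)
(* Write R for the rotation subgroup of D_2n. Every subgroup of R is normal, and
   these subgroups have orders the divisors of n. A normal subgroup containing a
   reflection x contains [r, x] = r^(+-2). If n is odd this generates R, so the
   only normal subgroup not contained in R is D_2n itself, and the sum of orders
   is 2n + D(n). If n is even, the whole group, R and the two subgroups
   <r^2, s>, <r^2, rs> of index 2 already contribute 5n >= 4n + 2. *)
Require Import Defs.
From mathcomp Require Import all_boot all_fingroup all_solvable.
From mathcomp Require Import zify.

Set Implicit Arguments.
Unset Strict Implicit.
Unset Printing Implicit Defensive.

Import GroupScope.

(** A cyclic group has exactly one subgroup of each order dividing its own, so taking orders is a
    bijection from subgroups to divisors. *)
Lemma sum_subgroup_orders_cyclic (gT : finGroupType) (R : {group gT}) :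
  cyclic R -> (\sum_(N : {group gT} | N \subset R) #|N|)%N = sum_divisors #|R|.
Proof.
move=> cycR; pose subR := enum [pred N : {group gT} | N \subset R].
transitivity (\sum_(d <- [seq #|gval N| | N <- subR]) d)%N.
  by rewrite big_map big_enum.
apply: perm_big; apply: uniq_perm.
- rewrite map_inj_in_uniq ?enum_uniq // => N M; rewrite !mem_enum !inE.
  by move=> sNR sMR /eqP; rewrite -(eq_subG_cyclic cycR) // => /eqP/val_inj.
- exact: divisors_uniq.
move=> d; rewrite -dvdn_divisors ?cardG_gt0 //.
apply/mapP/idP => [[N] | d_dvd].
  by rewrite mem_enum => sNR ->; apply: cardSg.
case/cyclicP: (cycR) => a defR; rewrite defR in d_dvd.
have /setP/(_ <[a ^+ (#[a] %/ d)]>%G) := cycle_sub_group d_dvd.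
rewrite !inE eqxx => /andP[sNR /eqP oN].
by exists <[a ^+ (#[a] %/ d)]>%G; rewrite ?mem_enum ?inE ?defR ?sNR ?oN.
Qed.

Section DihedralGenerators.

Variables (gT : finGroupType) (G : {group gT}) (r s : gT).
Hypotheses (defG : <[r]> * <[s]> = G) (s2 : s ^+ 2 = 1).
Hypotheses (notRs : s \notin <[r]>) (rs : r ^ s = r^-1).

Local Notation R := <[r]>.

Let Gr : r \in G.
Proof. by rewrite -defG (subsetP (mulG_subl _ _)) ?cycle_id. Qed.

Let Gs : s \in G.
Proof. by rewrite -defG (subsetP (mulG_subr _ _)) ?cycle_id. Qed.

Let order_s : #[s] = 2.
Proof.
apply/prime_nt_dvdP => //; last by rewrite order_dvdn s2.
by rewrite order_eq1; apply: contraNneq notRs => ->.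
Qed.

Lemma dihedral_card : #|G| = (2 * #[r])%N.
Proof.
rewrite -defG TI_cardMg -?orderE ?order_s 1?mulnC //.
by rewrite setIC prime_TIg -?orderE ?order_s // cycle_subG.
Qed.

Lemma reflectionP x : x \in G -> x \notin R -> exists2 a, a \in R & x = a * s.
Proof.
rewrite -defG => /mulsgP[a b Ra]; rewrite (cycle2g order_s) => /set2P[] -> ->.
  by rewrite mulg1 Ra.
by exists a.
Qed.

(** Writing [x = a * s] with [a] a power of [r], the factor [a] centralises [r], so [x] acts on [r]
    as [s] does. *)
Lemma reflection_conj x : x \in G -> x \notin R -> r ^ x = r^-1.
Proof.
move=> Gx /(reflectionP Gx)[a /cycleP[i ->] ->].
by rewrite conjgM (conjgE r) (commuteX i (commute_refl r)) mulKg.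
Qed.

Lemma reflection_involution x : x \in G -> x \notin R -> x ^+ 2 = 1.
Proof.
move=> Gx /(reflectionP Gx)[a /cycleP[i ->] ->].
have sV : s^-1 = s by apply/eqP; rewrite eq_invg_mul -(expgS s 1) s2.
have : (r ^+ i) ^ s = r ^- i by rewrite conjXg rs expgVn.
by rewrite conjgE sV => sris; rewrite expgS expg1 -mulgA sris mulgV.
Qed.

(** Subgroups of a cyclic group are characteristic in it, and [R] is normal because [s] inverts
    [r]. *)
Lemma rotation_subgroup_normal (N : {group gT}) : N \subset R -> N <| G.
Proof.
move=> sNR; apply: char_normal_trans (_ : R <| G).
  by rewrite sub_cyclic_char ?cycle_cyclic.
rewrite /normal cycle_subG Gr -defG mul_subG ?normG //.
by rewrite cycle_subG; apply/normP; rewrite -cycleJ rs cycleV.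
Qed.

Lemma rotation_square_mem (N : {group gT}) x :
  N <| G -> x \in N -> x \notin R -> r ^+ 2 \in N.
Proof.
case/andP=> sNG nNG Nx notRx.
have Gx := subsetP sNG x Nx.
have : [~ x, r] \in N.
  by rewrite groupM ?groupV ?memJ_norm ?(subsetP nNG).
rewrite -groupV invg_comm commgEl reflection_conj // -invMg groupV.
by rewrite expgS expg1.
Qed.

Lemma dihedral_odd_normal (N : {group gT}) :
  odd #[r] -> N <| G -> (N \subset R) || (N == G).
Proof.
move=> odd_r nsNG; case: (boolP (N \subset R)) => //= /subsetPn[x Nx notRx].
have Nr2 := rotation_square_mem nsNG Nx notRx.
have sRN : R \subset N.
  (* Squaring is invertible on a cyclic group of odd order. *)
  have : generator R (r ^+ 2) by rewrite generator_coprime coprimen2.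
  by move=> /eqP ->; rewrite cycle_subG.
have [a Ra defx] := reflectionP (subsetP (normal_sub nsNG) x Nx) notRx.
have Ns : s \in N by rewrite -(groupMl s (subsetP sRN a Ra)) -defx.
rewrite -val_eqE /= eqEsubset normal_sub //= -defG mul_subG //.
by rewrite cycle_subG.
Qed.

Lemma sum_normal_orders_dihedral_odd :
  odd #[r] -> sum_normal_orders G = (2 * #[r] + sum_divisors #[r])%N.
Proof.
move=> odd_r; rewrite /sum_normal_orders (bigD1 G) //= dihedral_card.
rewrite orderE -sum_subgroup_orders_cyclic ?cycle_cyclic //; congr (_ + _)%N.
apply: eq_bigl => N; apply/andP/idP => [[nsNG neqNG]|sNR].
  by have := dihedral_odd_normal odd_r nsNG; rewrite (negPf neqNG) orbF.
split; first exact: rotation_subgroup_normal.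
by apply: contraNneq notRs => eqNG; rewrite (subsetP sNR) ?eqNG.
Qed.

(** Modulo [<[r ^+ 2]>] the generators [r] and [s] commute, since their commutator is [r ^- 2].
    Hence [<[r ^+ 2]>] contains the derived subgroup, and every subgroup above it is normal. For the
    order, [<[r ^+ 2]>] has index 2 in [R], and [x] is an involution outside it. *)
Lemma reflection_subgroup_normal x :
  ~~ odd #[r] -> x \in G -> x \notin R ->
  <[r ^+ 2]> <*> <[x]> <| G /\ #|<[r ^+ 2]> <*> <[x]>| = #[r].
Proof.
move=> even_r Gx notRx; have x2 := reflection_involution Gx notRx.
have nsHG : <[r ^+ 2]> <| G by rewrite rotation_subgroup_normal ?cycleX.
have sHxG : <[r ^+ 2]> <*> <[x]> \subset G.
  by rewrite join_subG (normal_sub nsHG) cycle_subG.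
split.
  apply: sub_der1_normal => //; apply: subset_trans (joing_subl _ _).
  apply: der1_min (normal_norm nsHG) _.
  have nHr : r \in 'N(<[r ^+ 2]>) by rewrite (subsetP (normal_norm nsHG)).
  have nHs : s \in 'N(<[r ^+ 2]>) by rewrite (subsetP (normal_norm nsHG)).
  rewrite -defG quotientMl ?cycle_subG // !quotient_cycle // abelianM.
  rewrite !cycle_abelian /= cent_cycle cycle_subG; apply/cent1P/commgP.
  rewrite -morphR //= coset_id // -groupV invg_comm commgEl rs -invMg groupV.
  by rewrite -(expgS r 1) cycle_id.
have order_x : #[x] = 2.
  apply/prime_nt_dvdP => //; last by rewrite order_dvdn x2.
  by rewrite order_eq1; apply: contraNneq notRx => ->.
have sHR : <[r ^+ 2]> \subset R by rewrite cycleX.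
rewrite norm_joinEr ?cycle_subG ?(subsetP (normal_norm nsHG)) //.
rewrite TI_cardMg; last first.
  rewrite setIC prime_TIg -?orderE ?order_x // cycle_subG.
  by apply: contra notRx; apply: (subsetP sHR).
have dv2r : 2 %| #[r] by rewrite dvdn2.
by rewrite -!orderE order_x orderXdiv // divnK.
Qed.

Lemma sum_normal_orders_dihedral_even :
  1 < #[r] -> ~~ odd #[r] -> 5 * #[r] <= sum_normal_orders G.
Proof.
move=> r_gt1 even_r.
have notRrs : r * s \notin R by rewrite groupMl ?cycle_id.
have Grs := groupM Gr Gs.
have [nsM oM] := reflection_subgroup_normal even_r Gs notRs.
have [nsL oL] := reflection_subgroup_normal even_r Grs notRrs.
pose M := (<[r ^+ 2]> <*> <[s]>)%G; pose L := (<[r ^+ 2]> <*> <[r * s]>)%G.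
have Ms : s \in M by rewrite mem_gen // inE cycle_id orbT.
have Lrs : r * s \in L by rewrite mem_gen // inE cycle_id orbT.
have neq_ML : L != M.
  (* A common subgroup would contain [s] and [r * s], hence [r], hence all of [G], which is twice
     too large. *)
  apply/eqP => eqLM; have Mr : r \in M by rewrite -(groupMr r Ms) -eqLM.
  have : #|G| <= #|M|.
    by rewrite subset_leq_card // -defG mul_subG ?cycle_subG.
  rewrite dihedral_card oM; lia.
have neqG (N : {group gT}) : #|N| = #[r] -> N != G.
  by move=> oN; apply/eqP => eqNG; have := dihedral_card; rewrite -eqNG oN; lia.
have neqR (N : {group gT}) x : x \in N -> x \notin R -> N != <[r]>%G.
  by move=> Nx; apply: contraNneq => eqNR; rewrite eqNR in Nx.
(* Extract the four distinct terms [G], [R], [M], [L], which contribute 2 + 1 + 1 + 1 times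
   [#[r]]. *)
rewrite /sum_normal_orders (bigD1 G) //=.
rewrite (bigD1 <[r]>%G) /=; last by rewrite rotation_subgroup_normal ?neqG.
rewrite (bigD1 M) /=; last by rewrite nsM neqG ?(neqR _ s).
rewrite (bigD1 L) /=; last by rewrite nsL neqG ?(neqR _ (r * s)).
rewrite dihedral_card oM oL -orderE; lia.
Qed.

End DihedralGenerators.

(** The relations only bound the order of [r] by [n]. Counting against the known group order 2n
    excludes [s] from [<[r]>] and then forces [#[r] = n]. *)
Lemma dihedral_generators (n : nat) : 1 < n ->
  exists r s : 'D_(2 * n),
    [/\ <[r]> * <[s]> = [set: 'D_(2 * n)], #[r] = n, s ^+ 2 = 1,
        s \notin <[r]> & r ^ s = r^-1].
Proof.
move=> n_gt1; have /isoGrp_hom := Grp_dihedral n_gt1; rewrite -mul2n.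
case/existsP=> -[r s] /= /eqP[defG rn s2 rs]; exists r, s.
have {}defG : <[r]> * <[s]> = [set: 'D_(2 * n)].
  by rewrite -norm_joinEr // cycle_subG; apply/normP; rewrite -cycleJ rs cycleV.
have oD : #|[set: 'D_(2 * n)]| = (2 * n)%N.
  by rewrite mul2n card_dihedral.
have r_le_n : #[r] <= n by rewrite dvdn_leq ?order_dvdn ?rn //; lia.
have notRs : s \notin <[r]>.
  apply/negP => Rs; have : #|[set: 'D_(2 * n)]| <= #[r].
    by rewrite -defG mulGSid ?cycle_subG.
  by rewrite oD; lia.
split=> //; have := dihedral_card (G := [set: _]%G) defG s2 notRs.
by rewrite oD; lia.
Qed.

Theorem proposition5p2 (n : nat) (hn : 2 <= n) :
  [/\ quasi_Leinster [set: 'D_(2 * n)] <-> odd n /\ quasi_perfect n,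
      almost_Leinster [set: 'D_(2 * n)] <-> odd n /\ almost_perfect n
    & Leinster [set: 'D_(2 * n)] <-> odd n /\ perfect n].
Proof.
have [r [s [defG or s2 notRs rs]]] := dihedral_generators hn.
rewrite /quasi_Leinster /almost_Leinster /Leinster.
rewrite /quasi_perfect /almost_perfect /perfect.
have oG := dihedral_card (G := [set: _]%G) defG s2 notRs; rewrite oG.
have [odd_n|even_n] := boolP (odd n).
  rewrite (sum_normal_orders_dihedral_odd (G := [set: _]%G) defG) ?or //.
  by split; lia.
(* For even n both sides of each equivalence fail: as n is at least 2, 5n exceeds 4n + 1, the
   largest of the three targets. *)
have := sum_normal_orders_dihedral_even (G := [set: _]%G) defG s2 notRs rs.
rewrite or => /(_ hn even_n) bound; split; lia.
Qed.
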